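(* Let $q$ be a prime power, $m\geq5$, $F=\mathbb{F}_{q^m}$, and assume $\ell\geq2$ and $1\leq s<(m-2)/2$. Then every order-one direct-sum code $D_{\mathbf{s}}=D_{s_1}\oplus\cdots\oplus D_{s_\ell}$ with $\mathbf{s}=(s_1,\ldots,s_\ell)$, $s_i\ge 0$, $s_1+\cdots+s_\ell=s$ (see context) satisfies $$d_2(D_{\mathbf{s}})=m+\min_i s_i\leq m+\left\lfloor\frac{s}{\ell}\right\rfloor.$$ Let $W\leq F^{2\ell}$ be a maximum scattered $q$-system with associated MRD code $D_0$, let $\varphi:U_0\to F^s$ be an $\mathbb{F}_q$-linear map satisfying the independence condition $\dim_{\mathbb{F}_q}\overline E_Z=s$, and let $U_\varphi$ be the corresponding system (see context). If $$d_2(D_0)>m+\left\lfloor\frac{s}{\ell}\right\rfloor,$$ then $U_\varphi$ is not equivalent to any $q$-system associated with $D_{\mathbf{s}}^\perp$, for any order-one direct-sum code $D_{\mathbf{s}}$ with $s_1+\cdots+s_\ell=s$. The weaker inequality $d_2(D_0)>m$ gives the same conclusion for every tuple $\mathbf{s}$ having at least one $s_i=0$.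
   Context: Systems. An $[n,k]_{q^m/q}$ $q$-system is an $n$-dimensional $\mathbb{F}_q$-subspace $U\leq F^k$ with $\langle U\rangle_F=F^k$; $n$ is its rank. A maximum scattered system in $F^{2\ell}$ is a $q$-system $W$ of rank $\ell m$ with $\dim_{\mathbb{F}_q}(W\cap H)\leq1$ for every one-dimensional $F$-subspace $H$. Two systems in $F^k$ are equivalent if $U'=B(\sigma(U))$ for some $B\in\operatorname{GL}(k,F)$ and $\sigma\in\operatorname{Aut}(F)$ (full field automorphism group). Codes. An $[n,r]_{q^m/q}$ code is an $r$-dimensional $F$-subspace $C\leq F^n$. The rank weight of $x\in F^n$ is the $\mathbb{F}_q$-dimension of the span of its coordinates; $d(C)$ is the minimum rank weight of a nonzero word, and $[n,r,d]_{q^m/q}$ means $d(C)=d$. $C^\perp=\{y\in F^n: xy^\top=0\ \forall x\in C\}$. A code is nondegenerate if the columns of a generator matrix are $\mathbb{F}_q$-linearly independent; the $\mathbb{F}_q$-span of those columns is then a $q$-system, said to be associated with the code. Expanding $x\in F^n$ over an $\mathbb{F}_q$-basis of $F$ as an $m\times n$ matrix, $\operatorname{Rsupp}_q(x)$ is its row space; $\operatorname{Rsupp}_q(V)$ is the sum of supports of an $F$-basis of $V$; and $d_i(C)=\min\{\dim_{\mathbb{F}_q}\operatorname{Rsupp}_q(V): V\leq C,\ \dim_FV=i\}$ is the $i$-th generalized rank weight. MRD means meeting the Singleton bound $mr\leq\min\{m(n-d(C)+1),n(m-d(C)+1)\}$. Order-one direct-sum codes. Given nonnegative integers $\mathbf{s}=(s_1,\ldots,s_\ell)$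 with sum $s$, an order-one direct-sum code is $D_{\mathbf{s}}=D_{s_1}\oplus\cdots\oplus D_{s_\ell}$ on disjoint coordinate blocks, where each factor $D_{s_i}$ is any nondegenerate $[m+s_i,2,m-1]_{q^m/q}$ code. It is a nondegenerate $[\ell m+s,2\ell,m-1]_{q^m/q}$ code. Construction. Put $n_0=\ell m$, $k_0=\ell(m-2)$. Choose an ordered $\mathbb{F}_q$-basis of $W$ as the columns of $H_0\in F^{2\ell\times n_0}$, let $D_0$ be the $F$-row space of $H_0$ (an MRD code), choose a generator matrix $G_0\in F^{k_0\times n_0}$ of $D_0^\perp$ with columns $g_1,\ldots,g_{n_0}$ (these are $\mathbb{F}_q$-independent), and let $U_0\leq F^{k_0}$ be their $\mathbb{F}_q$-span. For $\mathbb{F}_q$-linear $\varphi:U_0\to F^s$ define $$U_\varphi=\{(u,\varphi(u)+a):u\in U_0,\ a\in\mathbb{F}_q^s\}\leq F^{k_0+s},$$ $\Phi=[\varphi(g_1)\ \cdots\ \varphi(g_{n_0})]$, $Z=-H_0\Phi^\top$ with columns $z_1,\ldots,z_s$, and $\overline E_Z=\langle z_1+W,\ldots,z_s+W\rangle_{\mathbb{F}_q}\leq F^{2\ell}/W$. *)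

(* Defs.v *)
From HB Require Import structures.
From mathcomp Require Import all_boot all_order all_algebra all_field.

Set Implicit Arguments.
Unset Strict Implicit.
Unset Printing Implicit Defensive.

Import GRing.Theory.
Local Open Scope ring_scope.

(* Throughout, [Fq] is a finite field and [F] a finite extension of it.
   Codes are F-subspaces of the F-space ['rV[F]_n].  Systems live in
   [F ^ k = {ffun 'I_k -> F}], whose library [vectType] structure is the one
   over [Fq]: hence [{vspace F ^ k}] is the type of Fq-subspaces of F^k, and
   its [\dim] is the dimension over [Fq]. *)

Definition is_min (P : nat -> Prop) (d : nat) : Prop :=
  P d /\ forall e, P e -> (d <= e)%N.

Section Columns.

Variables (Fq : finFieldType) (F : fieldExtType Fq).

Definition tocol k (x : F ^ k) : 'cV[F]_k := \col_i x i.

Definition ofcol k (x : 'cV[F]_k) : F ^ k := [ffun i => x i 0].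

Lemma tocolK k : cancel (@tocol k) (@ofcol k).
Proof. by move=> x; apply/ffunP=> i; rewrite ffunE mxE. Qed.

Lemma ofcolK k : cancel (@ofcol k) (@tocol k).
Proof. by move=> x; apply/colP=> i; rewrite mxE ffunE. Qed.

Definition cols k n (A : 'M[F]_(k, n)) : n.-tuple (F ^ k) :=
  [tuple ofcol (col j A) | j < n].

(* The Fq-subspace of F^k underlying an F-subspace. *)
Definition restrict_scalars k (H : {vspace 'cV[F]_k}) : {vspace F ^ k} :=
  limg (linfun (fun a : F ^ (\dim H) =>
    ofcol (\sum_(i < \dim H) a i *: (vbasis H)`_i))).

Lemma mem_restrict_scalars k (H : {vspace 'cV[F]_k}) (x : F ^ k) :
  (x \in restrict_scalars H) = (tocol x \in H).
Proof.
pose f (a : F ^ (\dim H)) := ofcol (\sum_(i < \dim H) a i *: (vbasis H)`_i).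
have f_lin : linear f.
  move=> c a b; apply/ffunP=> j; rewrite !ffunE !summxE scaler_sumr -big_split.
  by apply: eq_bigr => i _ /=; rewrite !mxE !ffunE mulrDl scalerAl.
pose fL : {linear (F ^ (\dim H))%type -> (F ^ k)%type} :=
  HB.pack f (GRing.isLinear.Build _ _ _ _ f f_lin).
apply/memv_imgP/idP => [[a _ ->]|Hx].
  rewrite (lfunE fL) /= /f ofcolK rpred_sum // => i _.
  by rewrite rpredZ // vbasis_mem // mem_nth // size_tuple.
exists [ffun i => coord (vbasis H) i (tocol x)]; first exact: memvf.
rewrite (lfunE fL) /= /f -[LHS]tocolK {1}(coord_vbasis Hx); congr (ofcol _).
by apply: eq_bigr => i _; rewrite ffunE.
Qed.

End Columns.

Section Systems.

Variables (Fq : finFieldType) (F : fieldExtType Fq).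

Definition q_system (n k : nat) (U : {vspace F ^ k}) : Prop :=
  \dim U = n /\ <<[seq tocol u | u <- vbasis U]>>%VS = fullv.

Definition max_scattered (m ell : nat) (W : {vspace F ^ (2 * ell)}) : Prop :=
  q_system (ell * m) W /\
  forall H : {vspace 'cV[F]_(2 * ell)},
    \dim H = 1%N -> (\dim (W :&: restrict_scalars H) <= 1)%N.

Definition system_equiv k (U U' : {vspace F ^ k}) : Prop :=
  exists (B : 'M[F]_k) (sigma : {rmorphism F -> F}),
    [/\ B \in unitmx, bijective sigma &
        forall x, x \in U' <->
          exists2 u, u \in U & tocol x = B *m map_mx sigma (tocol u)].

(* The canonical projection onto the quotient F^k / W, realized on the
   complement W^C; see [lker_quotv] and [limg_quotv]. *)
Definition quotv k (W : {vspace F ^ k}) : 'End((F ^ k)%type) := (\1 - projv W)%VF.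

Lemma lker_quotv k (W : {vspace F ^ k}) : lker (quotv W) = W.
Proof.
apply/vspaceP=> x; rewrite memv_ker !lfunE /= !lfunE /= subr_eq0.
by apply/eqP/idP => [->|Wx]; rewrite ?memv_proj ?projv_id.
Qed.

Lemma limg_quotv k (W : {vspace F ^ k}) : limg (quotv W) = (W^C)%VS.
Proof.
apply/eqP; rewrite eqEdim; apply/andP; split.
  apply/subvP=> _ /memv_imgP[x _ ->]; rewrite !lfunE /= !lfunE /=.
  exact: memv_projC.
rewrite dimv_compl -(limg_ker_dim (quotv W) fullv) lker_quotv capfv.
by rewrite addKn.
Qed.

(* {(u, phi u + a) : u \in U0, a \in Fq^s} *)
Definition ext_system k s (U0 : {vspace F ^ k}) (phi : 'Hom(subvs_of U0, (F ^ s)%type))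
    : {vspace F ^ (k + s)} :=
  limg (linfun (fun p : subvs_of U0 * 'rV[Fq]_s =>
    ofcol (col_mx (tocol (vsval p.1))
      (tocol (phi p.1) + \col_i (p.2 0 i)%:A)))).

Lemma mem_ext_system k s (U0 : {vspace F ^ k}) (phi : 'Hom(subvs_of U0, (F ^ s)%type))
    (x : F ^ (k + s)) :
  x \in ext_system phi <-> exists (u : subvs_of U0) (a : 'rV[Fq]_s),
    tocol x = col_mx (tocol (vsval u)) (tocol (phi u) + \col_i (a 0 i)%:A).
Proof.
pose f (p : subvs_of U0 * 'rV[Fq]_s) : F ^ (k + s) :=
  ofcol (col_mx (tocol (vsval p.1)) (tocol (phi p.1) + \col_i (p.2 0 i)%:A)).
have f_lin : linear f.
  move=> c p p'; apply/ffunP=> j; rewrite !ffunE.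
  case: (split_ordP j) => i ->; rewrite ?(col_mxEu, col_mxEd) !mxE.
    by rewrite linearP !ffunE.
  rewrite linearP !ffunE /= scalerDl !scalerDr -scalerA.
  by rewrite addrACA.
pose fL : {linear (subvs_of U0 * 'rV[Fq]_s)%type -> (F ^ (k + s))%type} :=
  HB.pack f (GRing.isLinear.Build _ _ _ _ f f_lin).
split=> [/memv_imgP[[u a] _ ->]|[u [a xE]]].
  by exists u, a; rewrite (lfunE fL) /= /f ofcolK.
apply/memv_imgP; exists (u, a); first exact: memvf.
by rewrite (lfunE fL) /= /f -xE tocolK.
Qed.

End Systems.

Section Codes.

Variables (Fq : finFieldType) (F : fieldExtType Fq).

Definition rank_weight n (x : 'rV[F]_n) : nat :=
  \dim <<[seq x 0%R j | j : 'I_n]>>%VS.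

Definition min_distance n (C : {vspace 'rV[F]_n}) : nat -> Prop :=
  is_min (fun d => exists2 x, x \in C & x != 0 /\ rank_weight x = d).

Definition is_code n (r d : nat) (C : {vspace 'rV[F]_n}) : Prop :=
  \dim C = r /\ min_distance C d.

Definition expand n (x : 'rV[F]_n) : 'M[Fq]_(\dim {:F}, n) :=
  \matrix_(i, j) coord (vbasis {:F}) i (x 0 j).

Definition Rsupp n (x : 'rV[F]_n) : 'M[Fq]_n := <<expand x>>%MS.

Definition Rsupp_space n (V : {vspace 'rV[F]_n}) : 'M[Fq]_n :=
  (\sum_(i < \dim V) Rsupp (vbasis V)`_i)%MS.

(* [gen_rank_weight C i d] says d_i(C) = d. *)
Definition gen_rank_weight n (C : {vspace 'rV[F]_n}) (i : nat) : nat -> Prop :=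
  is_min (fun d => exists V : {vspace 'rV[F]_n},
    [/\ (V <= C)%VS, \dim V = i & \rank (Rsupp_space V) = d]).

Definition generator_matrix k n (G : 'M[F]_(k, n)) (C : {vspace 'rV[F]_n})
    : Prop :=
  row_free G /\ <<[seq row i G | i : 'I_k]>>%VS = C.

Definition nondegenerate n (C : {vspace 'rV[F]_n}) : Prop :=
  exists G : 'M[F]_(\dim C, n), generator_matrix G C /\ free (cols G).

Definition associated_system k n (C : {vspace 'rV[F]_n}) (U : {vspace F ^ k})
    : Prop :=
  exists G : 'M[F]_(k, n),
    [/\ generator_matrix G C, free (cols G) & U = <<cols G>>%VS].

Definition dual n (C : {vspace 'rV[F]_n}) : {vspace 'rV[F]_n} :=
  (\bigcap_(i < \dim C) lker (linfun (mulmxr ((vbasis C)`_i)^T)))%VS.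

Lemma mem_dual n (C : {vspace 'rV[F]_n}) (y : 'rV[F]_n) :
  y \in dual C <-> forall x, x \in C -> x *m y^T = 0.
Proof.
have tr0 (x : 'rV[F]_n) : (y *m x^T = 0) <-> (x *m y^T = 0).
  by split=> /(congr1 trmx); rewrite trmx_mul trmxK trmx0.
rewrite memvE; split=> [/subv_bigcapP yC x /coord_vbasis -> | yC].
  rewrite mulmx_suml big1 // => i _; rewrite -scalemxAl.
  have /= := yC i isT; rewrite -memvE memv_ker lfunE /= => /eqP/tr0 ->.
  exact: scaler0.
apply/subv_bigcapP=> i _; rewrite -memvE memv_ker lfunE /=.
by apply/eqP/tr0/yC; rewrite vbasis_mem // mem_nth // size_tuple.
Qed.

Definition order_one_sum (m ell : nat) (s_ : 'I_ell -> nat)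
    (D : {vspace 'rV[F]_(\sum_(i < ell) (m + s_ i))}) : Prop :=
  exists C : forall i : 'I_ell, {vspace 'rV[F]_(m + s_ i)},
    (forall i, nondegenerate (C i) /\ is_code 2 m.-1 (C i)) /\
    (forall x, x \in D <-> forall i, submxrow x i \in C i).

End Codes.

Section Construction.

Variables (Fq : finFieldType) (F : fieldExtType Fq).

Definition row_code k n (H : 'M[F]_(k, n)) : {vspace 'rV[F]_n} :=
  <<[seq row i H | i : 'I_k]>>%VS.

Definition phi_mx k n s (G0 : 'M[F]_(k, n))
    (phi : 'Hom(subvs_of <<cols G0>>%VS, (F ^ s)%type)) : 'M[F]_(s, n) :=
  \matrix_(i, j) phi (vsproj <<cols G0>>%VS (tnth (cols G0) j)) i.

Definition Z_mx r k n s (H0 : 'M[F]_(r, n)) (G0 : 'M[F]_(k, n))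
    (phi : 'Hom(subvs_of <<cols G0>>%VS, (F ^ s)%type)) : 'M[F]_(r, s) :=
  - (H0 *m (phi_mx phi)^T).

Definition E_bar r s (W : {vspace F ^ r}) (Z : 'M[F]_(r, s)) : {vspace F ^ r} :=
  <<[seq quotv W z | z <- cols Z]>>%VS.

End Construction.

(* Main.v *)
Require Import Defs.
From HB Require Import structures.
From mathcomp Require Import all_boot all_order all_algebra all_field.
From mathcomp Require Import zify.

(** Everything reduces to one description of supports: over Fq, the space
    [Rsupp_space V] is the smallest subspace P of Fq^n such that V lies in the
    extension of scalars of P ([Rsupp_space_sub]).  Bounding a generalized
    weight from above is then exhibiting such a P, and supports can be pushed
    forward along matrices over Fq.

    Weights of a direct sum D.  Each summand, placed in its own block, is a
    two-dimensional subcode whose support has dimension at most the length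
    m + s_i ([order_one_sum_block]).  Conversely let V be a two-dimensional
    subcode of D.  If V projects onto some summand, its support has dimension
    at least m + s_i, since a nondegenerate code has full support.  Otherwise
    each projection V -> C_i has rank at most one, hence a kernel; kernels of
    two projections provide words u, w of V and blocks i, j with u nonzero in
    block i and zero in block j, and w the other way round.  The parts of their
    supports in these two blocks are independent, so the support of V has
    dimension at least 2(m - 1), which exceeds m + s
    ([order_one_sum_support]).

    Nonequivalence.  The system U_phi is spanned by the columns of
    [G0, 0; Phi, 1], whose dual code consists of the words (x, - x Phi^T)
    with x in D_0.  So deleting the last s coordinates is an injective map from
    that dual code into D_0, and it can only shrink supports.  An equivalence
    of systems turns into a semilinear map between the dual codes given by an
    injective matrix over Fq and a field automorphism; automorphisms of F
    preserve Fq, as its elements are the roots of X^q - X, and so they preserve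
    dimensions of supports.  Altogether an equivalence carries every subcode of
    D to a subcode of D_0 of the same dimension with no larger support
    ([system_equiv_subcode]), and d_2(D_0) <= m + s_i for every i.  This
    contradicts d_2(D_0) > m + floor(s / ell), because some s_i is at most the
    average, and it contradicts d_2(D_0) > m as soon as some s_i is 0. *)

Set Implicit Arguments.
Unset Strict Implicit.
Unset Printing Implicit Defensive.

Import GRing.Theory.
Local Open Scope ring_scope.

(** * Codes as row spaces, and their duals *)

Section RowCodes.

Variable (Fq : finFieldType) (F : fieldExtType Fq).

Lemma mem_row_code k n (M : 'M[F]_(k, n)) (x : 'rV[F]_n) :
  (x \in row_code M) = (x <= M)%MS.
Proof.
apply/idP/submxP => [|[w ->]].
  rewrite /row_code => /(@coord_span _ _ _ (in_tuple _)) ->.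
  apply/submxP/summx_sub => i _; apply: scalemx_sub.
  have: (in_tuple [seq row i M | i : 'I_k])`_i \in [seq row i M | i : 'I_k].
    by rewrite mem_nth.
  by case/mapP=> j _ ->; exact: row_sub.
rewrite mulmx_sum_row rpred_sum // => i _; rewrite rpredZ //.
by apply: memv_span; apply/mapP; exists i; rewrite // mem_enum.
Qed.

Lemma dim_row_code k n (M : 'M[F]_(k, n)) : row_free M -> \dim (row_code M) = k.
Proof.
move=> freeM; have szM : size [seq row i M | i : 'I_k] == k.
  by rewrite size_map size_enum_ord.
suff: free (Tuple szM).
  by rewrite /free /= (eqP szM) => /eqP.
apply/freeP => c c0 i; pose w := \row_i c i.
suff/rowP/(_ i): w = 0 by rewrite !mxE.
apply: (row_free_inj freeM); rewrite /= mul0mx mulmx_sum_row -[RHS]c0.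
apply: eq_bigr => j _; rewrite mxE; congr (_ *: _) => /=.
by rewrite (nth_map j) ?size_enum_ord // nth_ord_enum.
Qed.

Definition basis_mx n (V : {vspace 'rV[F]_n}) : 'M[F]_(\dim V, n) :=
  \matrix_i (vbasis V)`_i.

Lemma row_code_basis n (V : {vspace 'rV[F]_n}) : row_code (basis_mx V) = V.
Proof.
rewrite -[RHS](span_basis (vbasisP V)); congr <<_>>%VS.
apply: (@eq_from_nth _ 0); first by rewrite size_map size_enum_ord size_tuple.
rewrite size_map size_enum_ord => i ltiV.
by rewrite (nth_map (Ordinal ltiV)) ?size_enum_ord // rowK nth_enum_ord.
Qed.

Lemma memv_basis_mx n (V : {vspace 'rV[F]_n}) x :
  (x \in V) = (x <= basis_mx V)%MS.
Proof. by rewrite -mem_row_code row_code_basis. Qed.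

Lemma basis_mx_free n (V : {vspace 'rV[F]_n}) : row_free (basis_mx V).
Proof.
apply: inj_row_free => w wB0; apply/rowP => i; rewrite mxE.
have /freeP-> // := basis_free (vbasisP V).
by rewrite -[RHS]wB0 mulmx_sum_row; apply: eq_bigr => j _; rewrite rowK.
Qed.

Lemma dual_orth n (C : {vspace 'rV[F]_n}) k (G : 'M[F]_(k, n)) l
    (M : 'M[F]_(l, n)) :
  generator_matrix G (dual C) -> (row_code M <= C)%VS -> G *m M^T = 0.
Proof.
case=> _ defG MC; apply/row_matrixP => i; rewrite row_mul row0.
have Gi: row i G \in dual C.
  by rewrite -defG; apply: memv_span; apply/mapP; exists i; rewrite ?mem_enum.
apply/trmx_inj; rewrite trmx_mul trmxK trmx0; apply/row_matrixP => j.
rewrite row_mul row0; apply: (proj1 (mem_dual C (row i G)) Gi).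
by apply: (subvP MC); rewrite mem_row_code row_sub.
Qed.

(** This is the inclusion of the double dual in the code: the columns of
    [cokermx H] are parity checks of [row_code H], hence combinations of the
    rows of [G], and they cut out the row space of [H]. *)
Lemma submx_dual_dual k l p n (H : 'M[F]_(k, n)) (G : 'M[F]_(l, n))
    (Y : 'M[F]_(p, n)) :
  generator_matrix G (dual (row_code H)) -> G *m Y^T = 0 -> (Y <= H)%MS.
Proof.
case=> _ defG GY; rewrite submxE -[_ *m _]trmxK trmx_mul.
have /submxP[w ->] : ((cokermx H)^T <= G)%MS.
  apply/row_subP => i; rewrite -mem_row_code /row_code defG.
  apply/mem_dual => x; rewrite mem_row_code => /submxP[w ->].
  by rewrite tr_row trmxK -mulmxA colE (mulmxA H) mulmx_coker mul0mx mulmx0.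
by rewrite -mulmxA GY mulmx0 trmx0.
Qed.

End RowCodes.

(** * Coordinate blocks *)

Lemma submxrow_mul1 (R : pzSemiRingType) k l (n_ : 'I_l -> nat)
    (A : 'M[R]_(k, \sum_i n_ i)) i :
  submxrow A i = A *m submxrow 1%:M i.
Proof. by rewrite mul_submxrow mulmx1. Qed.

Lemma submxcol_block1 (R : pzSemiRingType) l (n_ : 'I_l -> nat) i :
  submxrow (submxcol (1%:M : 'M[R]_(\sum_i n_ i)) i) i = 1%:M.
Proof.
by apply/matrixP => a b; rewrite !mxE -val_eqE tagnat.eq_Rank eqxx.
Qed.

Lemma submxcol_block0 (R : pzSemiRingType) l (n_ : 'I_l -> nat) i j :
  i != j -> submxrow (submxcol (1%:M : 'M[R]_(\sum_i n_ i)) i) j = 0.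
Proof.
move=> neq_ij; apply/matrixP => a b.
by rewrite !mxE -val_eqE tagnat.eq_Rank (negPf neq_ij).
Qed.

(** * Matrices over the subfield, and rank supports *)

Section ScalarExtension.

Variable (Fq : finFieldType) (F : fieldExtType Fq).

Local Notation "P ^F" := (map_mx (GRing.in_alg F) P)
  (at level 2, format "P ^F").

Implicit Types (sigma : {rmorphism F -> F}).

(** The elements of [Fq] are the roots in [F] of X^q - X, a polynomial with
    coefficients in the prime field, so [sigma] permutes them; it need not fix
    each of them. *)
Lemma rmorph_scalar sigma (c : Fq) : exists c' : Fq, sigma c%:A = c'%:A.
Proof.
have: (map_poly (GRing.in_alg F) ('X^#|Fq| - 'X)).[sigma c%:A] = 0.
  rewrite rmorphB rmorphXn /= map_polyX hornerD hornerN hornerXn hornerX.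
  by rewrite -rmorphXn -(rmorphXn (GRing.in_alg F)) expf_card subrr.
rewrite finField_genPoly rmorph_prod horner_prod => /eqP.
case/prodf_eq0=> c' _; rewrite rmorphB /= map_polyX map_polyC hornerXsubC.
by rewrite subr_eq0 => /eqP; exists c'.
Qed.

Lemma rmorph_scalar_mx sigma k n (A : 'M[Fq]_(k, n)) :
  exists A' : 'M[Fq]_(k, n), map_mx sigma A^F = A'^F.
Proof.
have [f fE]: exists f : 'I_k * 'I_n -> Fq,
    forall x, sigma (A x.1 x.2)%:A = (f x)%:A.
  exact: fin_all_exists (fun x => rmorph_scalar sigma (A x.1 x.2)).
exists (\matrix_(i, j) f (i, j)).
by apply/matrixP => i j; rewrite !mxE (fE (i, j)).
Qed.

Lemma expand_mul n p (w : 'rV[F]_p) (P : 'M[Fq]_(p, n)) :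
  expand (w *m P^F) = expand w *m P.
Proof.
apply/matrixP => i j; rewrite !mxE linear_sum; apply: eq_bigr => k _.
by rewrite !mxE -scalerAr mulr1 linearZ /= mulrC.
Qed.

Lemma expandK n (x : 'rV[F]_n) :
  x = \row_i (vbasis {:F})`_i *m (expand x)^F.
Proof.
apply/rowP => j; rewrite mxE {1}(coord_vbasis (memvf (x 0 j))).
by apply: eq_bigr => i _; rewrite !mxE -scalerAr mulr1.
Qed.

(** The row space of [expand x] is the smallest subspace of [Fq ^ n] whose
    extension of scalars contains [x]. *)
Lemma expand_sub n p (x : 'rV[F]_n) (P : 'M[Fq]_(p, n)) :
  (expand x <= P)%MS = (x <= P^F)%MS.
Proof.
apply/idP/submxP => [xP | [w ->]]; last by rewrite expand_mul submxMl.
apply/submxP; rewrite [x]expandK; apply: submx_trans (submxMl _ _) _.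
by rewrite map_submx.
Qed.

Lemma Rsupp_space_sub n p (V : {vspace 'rV[F]_n}) (P : 'M[Fq]_(p, n)) :
  (Rsupp_space V <= P)%MS <-> forall v, v \in V -> (v <= P^F)%MS.
Proof.
split=> [/sumsmx_subP VP v /coord_vbasis -> | VP].
  apply: summx_sub => i _; apply: scalemx_sub; rewrite -expand_sub.
  by have := VP i isT; rewrite /Rsupp genmxE.
apply/sumsmx_subP => i _; rewrite /Rsupp genmxE expand_sub VP //.
by rewrite vbasis_mem // mem_nth // size_tuple.
Qed.

(** The coordinates of [x] are combinations over [Fq] of as many scalars as
    there are rows in a basis of the row space of [expand x]. *)
Lemma rank_weight_le n (x : 'rV[F]_n) : (rank_weight x <= \rank (expand x))%N.
Proof.
have /submxP[w xE]: (x <= (row_base (expand x))^F)%MS.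
  by rewrite -expand_sub eq_row_base.
pose X := [seq w 0 i | i : 'I_(\rank (expand x))].
have ->: \rank (expand x) = size X by rewrite size_map size_enum_ord.
apply: leq_trans (dim_span X); apply: dimvS.
apply/span_subvP => _ /mapP[j _ ->].
rewrite xE mxE rpred_sum // => i _; rewrite mxE -scalerAr mulr1 rpredZ //.
by apply: memv_span; apply/mapP; exists i; rewrite ?mem_enum.
Qed.

Lemma sum_cols k n (G : 'M[F]_(k, n)) (c : 'cV[Fq]_n) :
  \sum_j c j 0 *: (cols G)`_j = ofcol (G *m c^F).
Proof.
apply/ffunP => i; rewrite ffunE sum_ffunE mxE; apply: eq_bigr => j _.
by rewrite ffunE -tnth_nth tnth_mktuple ffunE !mxE -scalerAr mulr1.
Qed.

Lemma free_cols_inj k n (G : 'M[F]_(k, n)) (c : 'cV[Fq]_n) :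
  free (cols G) -> G *m c^F = 0 -> c = 0.
Proof.
move=> /freeP freeG Gc0; apply/colP => j; rewrite mxE.
apply: (freeG (fun j => c j 0)); rewrite sum_cols Gc0.
by apply/ffunP => i; rewrite !ffunE mxE.
Qed.

(** A rational subspace of smaller dimension lies in a rational hyperplane,
    whose equation would be a relation between the columns of a generator
    matrix. *)
Lemma nondegenerate_full n p (C : {vspace 'rV[F]_n}) (P : 'M[Fq]_(p, n)) :
  Defs.nondegenerate C -> (forall v, v \in C -> (v <= P^F)%MS) -> \rank P = n.
Proof.
case=> G [[_ defG] freeG] CP; apply/eqP; rewrite -/(row_full P) -cokermx_eq0.
apply/eqP/matrixP => i j.
suff: col j (cokermx P) = 0 by move/colP/(_ i); rewrite !mxE.
apply: (free_cols_inj freeG); apply/row_matrixP => k; rewrite row_mul row0.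
have /submxP[w ->]: (row k G <= P^F)%MS.
  apply: CP; have: row k G \in row_code G by rewrite mem_row_code row_sub.
  by rewrite /row_code defG.
rewrite -mulmxA -map_mxM /= colE mulmxA mulmx_coker mul0mx.
by rewrite map_mx0 mulmx0.
Qed.


(** * Supports in direct sums *)

Section DirectSums.

Variables (m l : nat) (s_ : 'I_l -> nat).
Variable D : {vspace 'rV[F]_(\sum_(i < l) (m + s_ i))}.
Hypothesis sumD : order_one_sum D.

(** The subcode is the [i]-th summand padded with zeros: the rows of [E] are
    the unit vectors of the block, and they span a rational space containing
    it. *)
Lemma order_one_sum_block i : exists V : {vspace 'rV[F]_(\sum_i (m + s_ i))},
  [/\ (V <= D)%VS, \dim V = 2 & (\rank (Rsupp_space V) <= m + s_ i)%N].
Proof.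
have [C [codeC memD]] := sumD; have [_ [dimC _]] := codeC i.
pose E (K : pzSemiRingType) := submxcol (1%:M : 'M[K]_(\sum_i (m + s_ i))) i.
have freeE: row_free (E F).
  apply/row_freeP; exists (submxrow 1%:M i).
  by rewrite -submxrow_mul1 submxcol_block1.
exists (row_code (basis_mx (C i) *m E F)); split.
- apply/subvP => x; rewrite mem_row_code => /submxP[w ->]; apply/memD => j.
  rewrite mulmxA -mul_submxrow; have [<-|neq_ij] := eqVneq i j.
    by rewrite submxcol_block1 mulmx1 memv_basis_mx submxMl.
  by rewrite submxcol_block0 // mulmx0 mem0v.
- rewrite dim_row_code //.
  by rewrite /row_free mxrankMfree //; exact: basis_mx_free.
apply: leq_trans (mxrankS _) (rank_leq_row (E Fq)).
apply/Rsupp_space_sub => v; rewrite mem_row_code => /submx_trans; apply.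
have -> : (E Fq)^F = E F by rewrite /E /submxcol map_mxsub map_mx1.
exact: submxMl.
Qed.

(** Either [V] projects onto a whole summand, whose support is full, or it
    contains words [u] and [w] such that one of two blocks is zero in [w] only
    and the other in [u] only, and two minimum distances add up; [b] has to
    satisfy the bounds of both cases. *)
Lemma order_one_sum_support (V : {vspace 'rV[F]_(\sum_i (m + s_ i))}) b :
    (V <= D)%VS -> \dim V = 2 -> (forall i, b <= m + s_ i)%N ->
  (b <= m.-1 + m.-1)%N -> (b <= \rank (Rsupp_space V))%N.
Proof.
move=> VD dimV le_b_s le_b_m; have [C [codeC memD]] := sumD.
have VC x i : x \in V -> submxrow x i \in C i.
  by move=> Vx; apply: (proj1 (memD x)); exact: (subvP VD).
set P := Rsupp_space V.
have VP : forall v, v \in V -> (v <= P^F)%MS by apply/Rsupp_space_sub.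
have mapE (i : 'I_l) :
    (submxrow (1%:M : 'M[Fq]_(\sum_i (m + s_ i))) i)^F = submxrow 1%:M i.
  by rewrite /submxrow map_mxsub map_mx1.
pose p i : 'Hom('rV[F]_(\sum_i (m + s_ i)), 'rV[F]_(m + s_ i)) :=
  linfun (mulmxr (submxrow (1%:M : 'M[F]_(\sum_i (m + s_ i))) i)).
have pE i x : p i x = submxrow x i by rewrite lfunE /= -submxrow_mul1.
have pC i : (p i @: V <= C i)%VS.
  by apply/subvP => _ /memv_imgP[x Vx ->]; rewrite pE; exact: VC.
case: (pickP (fun i => \dim (p i @: V) == 2)) => [i /eqP dimi | small].
  have eqC: (p i @: V)%VS = C i.
    by apply/eqP; rewrite eqEdim pC dimi; have [_ [-> _]] := codeC i.
  apply: leq_trans (le_b_s i) _.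
  have [nondeg _] := codeC i.
  rewrite -(nondegenerate_full (P := P *m submxrow 1%:M i) nondeg).
    exact: mxrankM_maxl.
  move=> v; rewrite -eqC => /memv_imgP[x /VP/submxP[w ->] ->].
  by rewrite map_mxM mapE pE submxrow_mul1 -mulmxA submxMl.
have kerV i : exists2 v, v \in V & v != 0 /\ submxrow v i = 0.
  have : (V :&: lker (p i))%VS != 0%VS.
    apply: contraFneq (small i) => ker0.
    by rewrite -dimV -(limg_ker_dim (p i) V) ker0 dimv0 add0n.
  rewrite -vpick0; set v := vpick _ => v0.
  have := memv_pick (V :&: lker (p i))%VS.
  rewrite memv_cap memv_ker pE => /andP[Vv /eqP vi].
  by exists v.
have nzblock (x : 'rV[F]_(\sum_i (m + s_ i))) :
    x != 0 -> exists i, submxrow x i != 0.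
  move=> x0; apply/existsP; apply: contraR x0.
  rewrite negb_exists => /forallP x0.
  by apply/eqP/mxrowP => i; rewrite submxrow0; apply/eqP/negPn/x0.
have V0: V != 0%VS by rewrite -dimv_eq0 dimV.
have [v Vv v0] : exists2 v, v \in V & v != 0.
  by exists (vpick V); rewrite ?memv_pick ?vpick0.
have [i vi] := nzblock v v0.
have [w Vw [w0 wi]] := kerV i.
have [j wj] := nzblock w w0.
have [u Vu [u0 uj]] := kerV j.
(* As [v] is nonzero in block [i], the kernel of [p i] in [V] is a line.  If
   [u] lay in it, [w] would be a multiple of [u], hence zero in block [j]. *)
have ui: submxrow u i != 0.
  apply: contraNneq wj => ui.
  have: w \in (V :&: lker (p i))%VS by rewrite memv_cap Vw memv_ker pE wi eqxx.
  suff <-: <[u]>%VS = (V :&: lker (p i))%VS.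
    case/vlineP=> c ->.
    by rewrite submxrow_mul1 -scalemxAl -submxrow_mul1 uj scaler0.
  apply/eqP; rewrite eqEdim -memvE memv_cap Vu memv_ker pE ui eqxx /=.
  rewrite dim_vline u0 /=.
  rewrite -(leq_add2r 1) [leqRHS](_ : _ = \dim V); last by rewrite dimV.
  rewrite -(limg_ker_dim (p i) V) leq_add2l lt0n dimv_eq0.
  apply: contraNneq vi => pV0; rewrite -pE -memv0 -pV0.
  exact: memv_img.
pose Q := col_mx (expand u) (expand w).
have QP: (Q <= P)%MS by rewrite col_mx_sub !expand_sub !VP.
apply: leq_trans (mxrankS QP).
pose E := row_mx (submxrow 1%:M i) (submxrow 1%:M j)
  : 'M[Fq]_(\sum_i (m + s_ i), (m + s_ i) + (m + s_ j)).
apply: leq_trans (mxrankM_maxl Q E).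
have expE (x : 'rV[F]_(\sum_i (m + s_ i))) a :
    expand x *m submxrow 1%:M a = expand (submxrow x a).
  by rewrite -expand_mul mapE -submxrow_mul1.
have exp0 n : expand (0 : 'rV[F]_n) = 0.
  by apply/matrixP => a c; rewrite !mxE linear0.
rewrite /Q /E mul_col_row !expE uj wi !exp0 rank_diag_block_mx.
have ge_m x a : x \in V -> submxrow x a != 0 ->
    (m.-1 <= \rank (expand (submxrow x a)))%N.
  move=> Vx xa; apply: leq_trans (rank_weight_le _).
  have [_ [_ [_ minC]]] := codeC a; apply: minC; exists (submxrow x a) => //.
  exact: VC.
by rewrite (leq_trans le_b_m) // leq_add // ge_m.
Qed.

End DirectSums.

(** * Extension systems and equivalence *)

Section ExtensionCodes.

Variables (k n r : nat) (H0 : 'M[F]_(r, n)) (G0 : 'M[F]_(k, n)) (s : nat).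
Variable phi : 'Hom(subvs_of <<cols G0>>%VS, (F ^ s)%type).

Let Gphi : 'M[F]_(k + s, n + s) := block_mx G0 0 (phi_mx phi) 1%:M.

Lemma ext_system_cols x : x \in ext_system phi ->
  exists a : 'cV[Fq]_(n + s), tocol x = Gphi *m a^F.
Proof.
case/mem_ext_system => u [a ->].
pose c : 'cV[Fq]_n := \col_j coord (cols G0) j (vsval u).
have uE : vsval u = \sum_j c j 0 *: (cols G0)`_j.
  by rewrite (coord_span (subvsP u)); apply: eq_bigr => j _; rewrite mxE.
exists (col_mx c a^T).
rewrite map_col_mx mul_block_col mul0mx addr0 mul1mx; congr col_mx.
  by rewrite uE sum_cols ofcolK.
congr (_ + _); last by apply/colP => i; rewrite !mxE.
have {1}-> : u = \sum_j c j 0 *: vsproj <<cols G0>>%VS (tnth (cols G0) j).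
  apply: subvs_inj; rewrite uE linear_sum; apply: eq_bigr => j _.
  rewrite linearZ; congr (_ *: _); rewrite -tnth_nth.
  exact/esym/vsprojK/memv_span/mem_tnth.
apply/colP => i; rewrite linear_sum !mxE sum_ffunE; apply: eq_bigr => j _.
by rewrite linearZ !ffunE !mxE -scalerAr mulr1.
Qed.

(** [Gphi] generates the code associated with [ext_system phi]; its dual is
    the graph of x |-> - x Phi^T over the dual of the row code
    of [G0]. *)
Lemma ext_code_dual p (Y : 'M[F]_(p, n + s)) :
  Gphi *m Y^T = 0 ->
  G0 *m (lsubmx Y)^T = 0 /\ Y = lsubmx Y *m row_mx 1%:M (- (phi_mx phi)^T).
Proof.
rewrite -{1}[Y]hsubmxK tr_row_mx mul_block_col mul0mx addr0 mul1mx.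
rewrite -[in RHS]col_mx0 => /eq_col_mx[-> /eqP]; rewrite addrC addr_eq0 => /eqP.
move/(congr1 trmx); rewrite trmxK linearN /= trmx_mul trmxK => rY.
by split; rewrite // mul_mx_row mulmx1 mulmxN -rY hsubmxK.
Qed.

(** If [G] generates the dual of [D], the equivalence gives
    G = B sigma(Gphi A) for a matrix [A] over [Fq], so v |-> tau(v) A^T sends
    [D] into the dual of [Gphi], where tau is the inverse of sigma.
    Independence of the columns of [G] makes this map injective, and the first
    [n] coordinates determine a word of the dual of [Gphi].  Supports are moved
    by tau, which permutes the rational subspaces, and by [A^T] with its last [s]
    columns deleted, a matrix over [Fq]. *)
Lemma system_equiv_subcode N (D V : {vspace 'rV[F]_N})
    (U' : {vspace F ^ (k + s)}) :
    generator_matrix G0 (dual (row_code H0)) ->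
    associated_system (dual D) U' -> system_equiv (ext_system phi) U' ->
    (V <= D)%VS ->
  exists V0 : {vspace 'rV[F]_n},
    [/\ (V0 <= row_code H0)%VS, \dim V0 = \dim V &
        (\rank (Rsupp_space V0) <= \rank (Rsupp_space V))%N].
Proof.
move=> genG0 [G [genG freeG defU']].
case=> B [sigma [unitB [tau sigmaK tauK] memU']] VD.
have [A AE] : exists A : 'M[Fq]_(n + s, N), G = B *m map_mx sigma (Gphi *m A^F).
  have colA j : exists a : 'cV[Fq]_(n + s),
      col j G = B *m map_mx sigma (Gphi *m a^F).
    have /memU'[u /ext_system_cols[a uE] GjE] : ofcol (col j G) \in U'.
      rewrite defU'; apply: memv_span.
      rewrite -[ofcol _](tnth_mktuple (fun j => ofcol (col j G))).
      exact: mem_tnth.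
    by exists a; rewrite -uE -GjE ofcolK.
  have [a aE] := fin_all_exists colA; exists (\matrix_(i, j) a j i 0).
  apply/trmx_inj/row_matrixP => j; rewrite -!tr_col aE; congr (_^T).
  rewrite [RHS]colE -mulmxA -(map_delta_mx sigma) -map_mxM -mulmxA.
  rewrite -(map_delta_mx (GRing.in_alg F)) -map_mxM -colE.
  congr (_ *m map_mx _ (_ *m map_mx _ _)).
  by apply/colP => i; rewrite !mxE.
pose tauM : {rmorphism F -> F} := HB.pack tau
  (GRing.isZmodMorphism.Build F F tau (can2_zmod_morphism sigmaK tauK))
  (GRing.isMonoidMorphism.Build F F tau (can2_monoid_morphism sigmaK tauK)).
have tauMK p q (M : 'M[F]_(p, q)) : map_mx tauM (map_mx sigma M) = M.
  by apply/matrixP => i j; rewrite !mxE; exact: sigmaK.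
pose M := basis_mx V.
have [A' A'E] := rmorph_scalar_mx sigma A.
have freeAt : row_free (A^F)^T.
  (* It is sigma(A), of the same rank as [A], that has no kernel: a relation
     between its columns over [Fq] is one between the columns of [G]. *)
  rewrite /row_free mxrank_tr -(mxrank_map sigma) A'E -mxrank_tr map_trmx.
  rewrite -/(row_free _) row_free_map; apply: inj_row_free => v vA'.
  apply/trmx_inj; rewrite trmx0; apply: (free_cols_inj freeG).
  rewrite AE map_mxM A'E -!mulmxA -map_mxM -[A' *m _]trmxK trmx_mul trmxK vA'.
  by rewrite trmx0 map_mx0 !mulmx0.
pose Y := map_mx tauM M *m (A^F)^T.
have GY : Gphi *m Y^T = 0.
  have: G *m M^T = 0 by apply: (dual_orth genG); rewrite row_code_basis.
  rewrite AE -mulmxA => /(congr1 (mulmx (invmx B))).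
  rewrite mulKmx // mulmx0 => /(congr1 (map_mx tauM)).
  by rewrite map_mxM tauMK map_mx0 /Y trmx_mul trmxK map_trmx mulmxA.
have [G0Y YE] := ext_code_dual GY.
have freeY : row_free (lsubmx Y).
  rewrite /row_free eqn_leq rank_leq_row /=.
  have rankY : \rank Y = \dim V.
    by rewrite mxrankMfree // mxrank_map; apply/eqP; exact: basis_mx_free.
  by rewrite -[leqLHS]rankY {1}YE mxrankM_maxl.
exists (row_code (lsubmx Y)); split.
- apply/subvP => x; rewrite !mem_row_code => /submx_trans; apply.
  exact: submx_dual_dual genG0 G0Y.
- exact: dim_row_code.
have [P PE] := rmorph_scalar_mx tauM (row_base (Rsupp_space V)).
pose Q := P *m lsubmx A^T.
apply: leq_trans (mxrankS _) (rank_leq_row Q).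
apply/Rsupp_space_sub => v; rewrite mem_row_code => /submx_trans; apply.
have -> : lsubmx Y = map_mx tauM M *m (lsubmx A^T)^F.
  by apply/matrixP => i j; rewrite !mxE; apply: eq_bigr => t _; rewrite !mxE.
rewrite map_mxM submxMr // -PE map_submx; apply/row_subP => i.
have: row i M \in V by rewrite memv_basis_mx row_sub.
move: (row i M); rewrite /M; apply/Rsupp_space_sub.
by rewrite eq_row_base.
Qed.

End ExtensionCodes.

End ScalarExtension.

(** * Minimum and average of the extra lengths *)

Lemma bigminn_le (I : finType) (f : I -> nat) b i :
  (\big[minn/b]_j f j <= f i)%N.
Proof. exact: (@Order.TotalTheory.bigmin_le _ nat I b i f). Qed.

Lemma bigminn_attained (I : finType) (f : I -> nat) b (i0 : I) :
  (forall i, f i <= b)%N -> exists i, \big[minn/b]_j f j = f i.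
Proof.
move=> le_f_b; exists (Order.arg_min i0 predT f).
by apply: (@Order.TotalTheory.bigmin_eq_arg _ nat I b i0 predT) => // i _.
Qed.

Lemma exists_le_average l (s_ : 'I_l -> nat) :
  (0 < l)%N -> exists i, (s_ i <= (\sum_j s_ j) %/ l)%N.
Proof.
move=> l0; case: (pickP (fun i => s_ i <= (\sum_j s_ j) %/ l)%N) => [i|large].
  by exists i.
have : (\sum_(j < l) ((\sum_j s_ j) %/ l).+1 <= \sum_j s_ j)%N.
  by apply: leq_sum => i _; rewrite ltnNge large.
by rewrite sum_nat_const card_ord mulnC leqNgt ltn_ceil.
Qed.

(** * Weights and nonequivalence *)

(* [\big[minn/s]_i s_ i] is min_i s_i: the default value s is the sum of the
   s_i, hence at least each of them. *)
Theorem proposition3p5 (Fq : finFieldType) (F : fieldExtType Fq)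
    (m ell s : nat) (hF : \dim {:F} = m) (hm : (5 <= m)%N)
    (hell : (2 <= ell)%N) (hs1 : (1 <= s)%N) (hs2 : (2 * s < m - 2)%N) :
  (forall (s_ : 'I_ell -> nat)
      (D : {vspace 'rV[F]_(\sum_(i < ell) (m + s_ i))}),
      (\sum_(i < ell) s_ i)%N = s ->
      order_one_sum D ->
      gen_rank_weight D 2 (m + \big[minn/s]_(i < ell) s_ i) /\
      (m + \big[minn/s]_(i < ell) s_ i <= m + s %/ ell)%N)
  /\
  (forall (W : {vspace F ^ (2 * ell)})
      (H0 : 'M[F]_(2 * ell, ell * m))
      (G0 : 'M[F]_(ell * (m - 2), ell * m))
      (phi : 'Hom(subvs_of <<cols G0>>%VS, (F ^ s)%type)) (d2 : nat),
      max_scattered m W ->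
      basis_of W (cols H0) ->
      generator_matrix G0 (dual (row_code H0)) ->
      \dim (E_bar W (Z_mx H0 phi)) = s ->
      gen_rank_weight (row_code H0) 2 d2 ->
      ((m + s %/ ell < d2)%N ->
        forall (s_ : 'I_ell -> nat)
          (D : {vspace 'rV[F]_(\sum_(i < ell) (m + s_ i))})
          (U' : {vspace F ^ (ell * (m - 2) + s)}),
          (\sum_(i < ell) s_ i)%N = s ->
          order_one_sum D ->
          associated_system (dual D) U' ->
          ~ system_equiv (ext_system phi) U')
      /\
      ((m < d2)%N ->
        forall (s_ : 'I_ell -> nat)
          (D : {vspace 'rV[F]_(\sum_(i < ell) (m + s_ i))})
          (U' : {vspace F ^ (ell * (m - 2) + s)}),
          (\sum_(i < ell) s_ i)%N = s ->
          (exists i, s_ i = 0%N) ->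
          order_one_sum D ->
          associated_system (dual D) U' ->
          ~ system_equiv (ext_system phi) U')).
Proof.
have min_le (s_ : 'I_ell -> nat) : (\sum_(i < ell) s_ i)%N = s ->
    (\big[minn/s]_(i < ell) s_ i <= s %/ ell)%N.
  move=> sum_s; have [|i] := exists_le_average s_; first exact: ltnW.
  by rewrite sum_s; apply: leq_trans; exact: bigminn_le.
split=> [s_ D sum_s sumD | W H0 G0 phi d2 _ _ genG0 _ [_ min_d2]].
  split; last by rewrite leq_add2l min_le.
  have lower V : (V <= D)%VS -> \dim V = 2 ->
      (m + \big[minn/s]_(i < ell) s_ i <= \rank (Rsupp_space V))%N.
    move=> VD dimV; apply: (order_one_sum_support sumD VD dimV) => [i|].
      by rewrite leq_add2l bigminn_le.
    have: (\big[minn/s]_(i < ell) s_ i <= s)%N.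
      by apply: leq_trans (min_le _ sum_s) (leq_div _ _).
    by move: hm hs2; lia.
  split; last by move=> e [V [VD dimV <-]]; exact: lower.
  have [i min_i] : exists i, \big[minn/s]_(i < ell) s_ i = s_ i.
    apply: bigminn_attained (Ordinal (ltnW hell)) _ => i.
    by rewrite -sum_s (bigD1 i) //= leq_addr.
  have [V [VD dimV leV]] := order_one_sum_block sumD i.
  by exists V; split=> //; apply/eqP; rewrite eqn_leq lower // min_i leV.
have d2_le (s_ : 'I_ell -> nat)
    (D : {vspace 'rV[F]_(\sum_(i < ell) (m + s_ i))})
    (U' : {vspace F ^ (ell * (m - 2) + s)}) i :
    order_one_sum D -> associated_system (dual D) U' ->
    system_equiv (ext_system phi) U' -> (d2 <= m + s_ i)%N.
  move=> sumD assU' equivU'.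
  have [V [VD dimV leV]] := order_one_sum_block sumD i.
  have [V0 [V0H dimV0 leV0]] := system_equiv_subcode genG0 assU' equivU' VD.
  apply: leq_trans (leq_trans leV0 leV); apply: min_d2; exists V0.
  by rewrite dimV0.
split=> lt_d2 s_ D U' sum_s.
  move=> sumD assU' equivU'.
  have [|i] := exists_le_average s_; first exact: ltnW.
  rewrite sum_s -(leq_add2l m) leqNgt; case/negP.
  exact: leq_trans lt_d2 (d2_le _ _ _ i sumD assU' equivU').
case=> i si0 sumD assU' equivU'.
by have := d2_le _ _ _ i sumD assU' equivU'; rewrite si0 addn0 leqNgt lt_d2.
Qed.
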